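(* Let $(M,d)$ be a finite metric space with $N+1$ points and a distinguished point $0\in M$. A basis $(b_n)_{n=1}^N$ of $\mathcal{F}(M)$ is stochastic if and only if there exist nonzero real numbers $(\rho_n)_{n=1}^N$, an order $F\in\Sigma(M)$, and a tuple $(\lambda_{n,i})_{0\le i<n\le N}\subset[0,1]$ with $\sum_{i=0}^{n-1}\lambda_{n,i}=1$ for every $1\leq n\leq N$ such that $$b_n=\rho_n\Big(\delta_{F(n)}-\sum_{i<n}\lambda_{n,i}\delta_{F(i)}\Big)\qquad\text{for } n=1,\dots,N.$$ Therefore (in this case), for every $n=1,\dots,N$, $$\|b_n\|=|\rho_n|\sum_{i<n}\lambda_{n,i}\,d(F(n),F(i)).$$
   Context: $\mathrm{Lip}_0(M)$ is the space of functions $f:M\to\mathbb{R}$ with $f(0)=0$, normed by the least Lipschitz constant; $\mathcal{F}(M)$ is its dual normed space, of dimension $N$. An element of $\mathcal{F}(M)$ is represented by a function $\mu:M\to\mathbb{R}$ acting by $\langle\mu,f\rangle=\sum_{x\in M}\mu(x)f(x)$; the value $\mu(0)$ is irrelevant. $\delta_x$ is the indicator function of $x$ (so $\delta_0=0$ in $\mathcal{F}(M)$). $\Sigma(M)$ is the set of bijections $F:\{0,\dots,N\}\to M$ with $F(0)=0$. For $S\subset M$ with $0\in S$, $\mathcal{F}(S)$ is identified with the span of $\{\delta_x:x\in S\}$ in $\mathcal{F}(M)$. A stochastic retraction onto $S$ is a map $R$ from $M$ to the probability measures on $S$ with $R(x)=\delta_x$ for $x\in S$; viewing probability measures on $S$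 as elements of $\mathcal{F}(S)$, it extends to the linear projection $\widehat R:\mathcal{F}(M)\to\mathcal{F}(S)$ with $\widehat R(\delta_x)=R(x)$, also called a stochastic retraction. For a basis $(b_n)_{n=1}^N$ of $\mathcal{F}(M)$ with dual basis $(b_n^* )_{n=1}^N$, the canonical projections are $P_n(x)=\sum_{i=1}^nb_i^*(x)b_i$, $n=1,\dots,N$. The basis is stochastic if all its canonical projections are stochastic retractions. *)

(* Defs.v *)
From HB Require Import structures.
From mathcomp Require Import all_boot all_order all_algebra.
From mathcomp Require Import all_classical all_reals all_analysis.
Set Implicit Arguments.
Unset Strict Implicit.
Unset Printing Implicit Defensive.
Import Order.TTheory GRing.Theory Num.Theory.
Local Open Scope classical_set_scope.
Local Open Scope ring_scope.

#[short(type="finMetricType")]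
HB.structure Definition FinMetric (R : numDomainType) :=
  { M of Finite M & Metric R M }.

Section LipschitzFree.
Context {R : realType} {M : finMetricType R} (o : M).

Definition lip0 : {vspace {ffun M -> R^o}} :=
  lker (linfun (fun f : {ffun M -> R^o} => f o : R^o)).

Notation Lip0 := (subvs_of lip0).

Lemma mem_lip0 (f : {ffun M -> R^o}) : (f \in lip0) = (f o == 0).
Proof.
have ev : linear (fun f : {ffun M -> R^o} => f o : R^o).
  by move=> a u v; rewrite !ffunE.
pose L := GRing.isLinear.Build _ _ _ _ _ ev.
pose ev' : {linear _ -> _} := HB.pack (fun f : {ffun M -> R^o} => f o : R^o) L.
by rewrite memv_ker (lfunE ev').
Qed.

Definition lip_norm (f : Lip0) : R :=
  inf [set k : R | 0 <= k /\
    forall x y : M, `|vsval f x - vsval f y| <= k * mdist x y].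

Lemma lip_normP (f : Lip0) : 0 <= lip_norm f /\
  forall x y : M, `|vsval f x - vsval f y| <= lip_norm f * mdist x y.
Proof.
pose A := [set k : R | 0 <= k /\
    forall x y : M, `|vsval f x - vsval f y| <= k * mdist x y].
have A0 : A !=set0.
  exists (\sum_(p : M * M) `|vsval f p.1 - vsval f p.2| / mdist p.1 p.2).
  split=> [|x y]; first by apply: sumr_ge0 => p _; rewrite divr_ge0 ?mdist_ge0.
  have [->|xy] := eqVneq x y.
    by rewrite subrr normr0 metric_structure.mdistxx mulr0.
  have d0 : 0 < mdist x y by rewrite mdist_gt0.
  rewrite -ler_pdivrMr // (bigD1 (x, y)) //= lerDl.
  by apply: sumr_ge0 => p _; rewrite divr_ge0 ?mdist_ge0.
split; first by apply: lb_le_inf => // k [].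
move=> x y; have [->|xy] := eqVneq x y.
  by rewrite subrr normr0 metric_structure.mdistxx mulr0.
have d0 : 0 < mdist x y by rewrite mdist_gt0.
rewrite -ler_pdivrMr //; apply: lb_le_inf => // k [_ kP].
by rewrite ler_pdivrMr.
Qed.

Definition lfree : vectType R := 'Hom(Lip0, R^o).

Definition lfree_norm (mu : 'Hom(Lip0, R^o)) : R :=
  sup [set `|mu f| | f in [set f : Lip0 | lip_norm f <= 1]].

(* The functional represented by a function mu on M; mu o is irrelevant. *)
Definition elem (mu : {ffun M -> R}) : lfree :=
  linfun (fun f : Lip0 => \sum_x mu x * vsval f x : R^o).

Lemma elemE mu (f : Lip0) : elem mu f = \sum_x mu x * vsval f x.
Proof.
have ev : linear (fun f : Lip0 => \sum_x mu x * vsval f x : R^o).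
  move=> a u v; rewrite scaler_sumr -big_split; apply: eq_bigr => x _ /=.
  by rewrite !ffunE mulrDr; congr (_ + _); rewrite [LHS]mulrCA.
pose L := GRing.isLinear.Build _ _ _ _ _ ev.
pose ev' : {linear _ -> _} :=
  HB.pack (fun f : Lip0 => \sum_x mu x * vsval f x : R^o) L.
exact: (lfunE ev').
Qed.

Definition point_mass (x : M) : {ffun M -> R} := [ffun y => (y == x)%:R].

Definition delta (x : M) : lfree := elem (point_mass x).

Lemma deltaE x (f : Lip0) : delta x f = vsval f x.
Proof.
rewrite elemE (bigD1 x) //= ffunE eqxx mul1r big1 ?addr0 // => y /negPf yx.
by rewrite ffunE yx mul0r.
Qed.

Definition is_prob_on (S : {set M}) (p : {ffun M -> R}) : Prop :=
  [/\ forall x, 0 <= p x, forall x, x \notin S -> p x = 0 & \sum_x p x = 1].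

(* T is the linear extension of a map from M to the probability measures on S
   fixing the points of S. *)
Definition stoch_retraction (S : {set M}) (T : 'End(lfree)) : Prop :=
  exists r : M -> {ffun M -> R},
    [/\ forall x, is_prob_on S (r x),
        forall x, x \in S -> r x = point_mass x
      & forall x, T (delta x) = elem (r x)].

(* tnth b i is b_(i+1), and coord b i is the dual vector b_(i+1)^*. *)
Definition canon_proj (N : nat) (b : N.-tuple lfree) (n : nat) : 'End(lfree) :=
  linfun (fun x : lfree => \sum_(i < N | (i < n)%N) coord b i x *: tnth b i).

Lemma canon_projE (N : nat) (b : N.-tuple lfree) (n : nat) (x : lfree) :
  canon_proj b n x = \sum_(i < N | (i < n)%N) coord b i x *: tnth b i.
Proof.
pose P (x : lfree) := \sum_(i < N | (i < n)%N) coord b i x *: tnth b i.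
have lP : linear P.
  move=> a u v; rewrite /P scaler_sumr -big_split; apply: eq_bigr => i _ /=.
  by rewrite linearP scalerDl scalerA.
pose L := GRing.isLinear.Build _ _ _ _ _ lP.
pose P' : {linear _ -> _} := HB.pack P L.
exact: (lfunE P').
Qed.

Definition stoch_basis (N : nat) (b : N.-tuple lfree) : Prop :=
  forall n : nat, (1 <= n <= N)%N ->
    exists2 S : {set M}, o \in S & stoch_retraction S (canon_proj b n).

Definition is_order (N : nat) (F : 'I_N.+1 -> M) : Prop :=
  bijective F /\ F ord0 = o.

Definition is_weights (N : nat) (lam : 'I_N.+1 -> 'I_N.+1 -> R) : Prop :=
  (forall n i : 'I_N.+1, (i < n)%N -> 0 <= lam n i <= 1) /\
  (forall n : 'I_N.+1, (1 <= n)%N ->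
     \sum_(i < N.+1 | (i < n)%N) lam n i = 1).

(* For n : 'I_N, tnth b n and rho n stand for b_(n+1) and rho_(n+1), while F and
   lam are indexed by 0, ..., N; lift ord0 n is the index n + 1 in 'I_N.+1. *)
Definition stoch_form (N : nat) (b : N.-tuple lfree) (rho : 'I_N -> R)
    (F : 'I_N.+1 -> M) (lam : 'I_N.+1 -> 'I_N.+1 -> R) : Prop :=
  [/\ forall n, rho n != 0, is_order F, is_weights lam
    & forall n : 'I_N, let m := lift ord0 n in
        tnth b n =
        rho n *: (delta (F m)
                  - \sum_(i < N.+1 | (i < m)%N) lam m i *: delta (F i))].

End LipschitzFree.

(* Main.v *)
Require Import Defs.
From mathcomp Require Import all_boot all_order all_algebra.
From mathcomp Require Import all_classical all_reals all_analysis.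
Import Order.TTheory GRing.Theory Num.Theory.
Local Open Scope ring_scope.

Set Implicit Arguments.
Unset Strict Implicit.
Unset Printing Implicit Defensive.

(** Write P_n for the canonical projections, with P_0 = 0, and A_n for the set
    of the points x with P_n delta_x = delta_x.

    From stochastic to the triangular form.  Testing against a bump function
    at x shows that a stochastic retraction onto S fixes delta_x only when x
    lies in S (stoch_retraction_memE); so the set onto which P_n retracts must
    be A_n.  As P_l P_k = P_k for k <= l, the sets A_n increase, starting from
    A_0 = {o}.  The vector b_(n+1) is in the image of P_(n+1), hence
    a combination of the delta_x with x in A_(n+1), and P_n kills it; applying
    1 - P_n to that combination leaves
      b_(n+1) = sum over x in A_(n+1) \ A_n of c_x (delta_x - P_n delta_x)
    (tnth_basis_decomp).  As b_(n+1) <> 0, some x occurs in this sum, so that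
    each A_n is strictly smaller than A_(n+1).  There are N + 1 sets in the
    chain and N + 1 points in M, so each step adds exactly one point
    (chain_enum); calling it F(n+1), the sum has a single term, and
    P_n delta_F(n+1) is a probability measure on A_n = F{0, ..., n}: its masses
    are the weights lambda.

    From the triangular form to stochastic.  Solved for delta_F(i), the formula
    says that delta_F(i) is a multiple of b_i plus an average of the earlier
    delta_F(l).  Since P_n fixes b_i for i <= n and kills it for i > n,
    induction on i shows that P_n fixes delta_F(i) for i <= n, and that
    for i > n it sends it to an average of probability measures carried by
    F{0, ..., n} (stoch_form_basis).

    The norm.  Against a 1-Lipschitz f, delta_x - sum of w_i delta_(p_i) gives
    the sum of w_i (f x - f p_i), at most the sum of w_i d(x, p_i), and the
    function d(x, .) - d(x, o) attains this bound up to sign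
    (lfree_norm_barycenter). *)

(** * Chains of sets that grow one point at a time *)

(** A strictly increasing chain of N + 1 sets that starts at a singleton has no
    room, in N + 1 points, to gain more than one point at a step.  Counting is
    done by choosing one new point per step: the choices are distinct, hence
    exhaust T. *)
Lemma chain_enum (T : finType) (o : T) (N : nat) (A : nat -> {set T}) :
  #|T| = N.+1 -> A 0%N = [set o]%SET ->
  {homo A : k l / (k <= l)%N >-> k \subset l} ->
  (forall k, (k < N)%N -> ~~ (A k.+1 \subset A k)) ->
  exists F : 'I_N.+1 -> T,
    [/\ bijective F, F ord0 = o
      & forall (i : 'I_N.+1) k, (F i \in A k) = (i <= k)%N].
Proof.
move=> cardT A0 Amono Astrict.
have /choice[g gP] : forall j : 'I_N,
    exists x, x \in A j.+1 :\: A j.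
  move=> j; have /fintype.subsetPn[x xS xNS] := Astrict j (ltn_ord j).
  by exists x; rewrite finset.inE xNS.
pose F i := if unlift ord0 i is Some j then g j else o.
have memF (i : 'I_N.+1) k : (F i \in A k) = (i <= k)%N.
  rewrite /F; case: unliftP => [j ->|->]; last first.
    by rewrite (fintype.subsetP (Amono 0%N k _)) // A0 finset.inE.
  have := gP j; rewrite finset.inE => /andP[gN gA].
  rewrite lift0; case: ltnP => [jk|kj]; first exact:
    (fintype.subsetP (Amono _ _ jk) _ gA).
  by apply/negbTE; apply: contra gN; exact: (fintype.subsetP (Amono _ _ kj)).
exists F; split=> //; last by rewrite /F unlift_none.
apply: inj_card_bij; last by rewrite cardT card_ord.
move=> i j Fij; apply: val_inj; apply/eqP.
by rewrite eqn_leq -memF Fij -memF -{2}Fij !memF !leqnn.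
Qed.

(** * The Lipschitz-free space and stochastic retractions *)

Section FreeSpace.
Context {R : realType} {M : finMetricType R} (o : M).
Implicit Types (S : {set M}) (T : 'End(lfree o)) (v : lfree o).

Lemma delta_base : delta o o = 0.
Proof.
apply/lfunP => f; rewrite deltaE zero_lfunE.
by apply/eqP; rewrite -mem_lip0 subvsP.
Qed.

Lemma elem_delta p : elem o p = \sum_x p x *: delta o x.
Proof.
apply/lfunP => f; rewrite elemE sum_lfunE; apply: eq_bigr => x _.
by rewrite scale_lfunE deltaE.
Qed.

Lemma point_mass_prob S x : x \in S ->
  is_prob_on S (point_mass x : {ffun M -> R}).
Proof.
move=> xS; split=> [y|y yS|]; rewrite ?ffunE ?ler0n //.
  by case: eqP yS => // ->; rewrite xS.
rewrite (bigD1 x) //= ffunE eqxx big1 ?addr0 // => y /negPf yx.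
by rewrite ffunE yx.
Qed.

(** The factor [x != o] makes the bump at the base point zero, so that it
    stays in Lip_0; the bumps are then dual to the point masses, delta_o = 0
    included. *)
Definition lip_bump (x : M) : subvs_of (lip0 o) :=
  vsproj (lip0 o) [ffun y => ((y == x) && (x != o))%:R].

Lemma lip_bumpE x y : vsval (lip_bump x) y = ((y == x) && (x != o))%:R.
Proof.
rewrite vsprojK ?ffunE // mem_lip0 ffunE (eq_sym o x).
by case: (x == o); rewrite eqxx.
Qed.

(** Every f in Lip_0 is the sum of the f(x) times the bump at x, so that
    a functional is determined by its values c x on the bumps. *)
Lemma lfree_span v : exists c : M -> R, v = \sum_x c x *: delta o x.
Proof.
exists (fun x => v (lip_bump x)); apply/lfunP => f.
rewrite sum_lfunE.
have fE : f = \sum_x (vsval f x : R) *: lip_bump x.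
  apply: val_inj; apply/ffunP => y.
  rewrite [in RHS]/= raddf_sum /= sum_ffunE (bigD1 y) //= ffunE.
  rewrite lip_bumpE eqxx /= big1 ?addr0 => [|x /negPf xy]; last first.
    by rewrite ffunE lip_bumpE eq_sym xy /= scaler0.
  have [->|_] := eqVneq y o; last by rewrite [RHS]mulr1.
  rewrite scaler0; apply/eqP; rewrite -mem_lip0; exact: subvsP.
rewrite {1}fE raddf_sum; apply: eq_bigr => x _.
by rewrite /= linearZ scale_lfunE deltaE [LHS]mulrC.
Qed.

(** If x is not in S, the bump at x separates delta_x from every measure on S.
    The base point needs o in S, because delta_o = 0 is always fixed. *)
Lemma stoch_retraction_memE S T x : o \in S -> stoch_retraction S T ->
  (T (delta o x) == delta o x) = (x \in S).
Proof.
move=> oS [r [rprob rS Tr]]; apply/idP/idP => [|xS]; last first.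
  by rewrite Tr rS.
rewrite Tr; apply: contraTT => xNS.
have xo : x != o by apply: contraNneq xNS => ->.
apply/eqP => /lfunP/(_ (lip_bump x)).
rewrite elemE deltaE lip_bumpE eqxx xo /=.
rewrite big1 => [/esym/eqP|y _]; first by rewrite oner_eq0.
rewrite lip_bumpE xo andbT; have [->|_] := eqVneq y x; last by rewrite mulr0.
by have [_ -> //] := rprob x; rewrite mul0r.
Qed.

Lemma stoch_retraction_range S T v : stoch_retraction S T ->
  exists c : M -> R, T v = \sum_(x in S) c x *: delta o x.
Proof.
move=> [r [rprob rS Tr]]; have [c ->] := lfree_span v.
exists (fun x => \sum_y c y * r y x).
transitivity (\sum_x (\sum_y c y * r y x) *: delta o x).
  rewrite raddf_sum; under [RHS]eq_bigr do rewrite scaler_suml.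
  rewrite exchange_big; apply: eq_bigr => y _.
  rewrite /= linearZ /= Tr elem_delta scaler_sumr.
  by apply: eq_bigr => x _; rewrite scalerA.
rewrite [RHS]big_mkcond; apply: eq_bigr => x _.
case: ifPn => // xNS; rewrite big1 ?scale0r // => y _.
by have [_ -> //] := rprob y; rewrite mulr0.
Qed.

(** Lets the projection of index 0 start the chain of retractions. *)
Lemma stoch_retraction0 : stoch_retraction [set o]%SET (0 : 'End(lfree o)).
Proof.
exists (fun=> point_mass o); split=> [x|x|x].
- by apply: point_mass_prob; rewrite finset.inE.
- by rewrite finset.inE => /eqP ->.
by rewrite zero_lfunE -[RHS]/(delta o o) delta_base.
Qed.

Lemma lip_norm_le1 (f : subvs_of (lip0 o)) :
  (forall x y, `|vsval f x - vsval f y| <= mdist x y) -> lip_norm f <= 1.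
Proof.
move=> fP; apply: ge_inf; first by exists 0 => k [].
by split=> // x y; rewrite mul1r.
Qed.

(** The bound holds termwise by the Lipschitz inequality, and all the
    inequalities become equalities at once for the distance to x, shifted to
    vanish at o. *)
Lemma lfree_norm_barycenter (I : finType) (P : pred I) (w : I -> R)
    (p : I -> M) (x : M) (a : R) :
  (forall i, P i -> 0 <= w i) -> \sum_(i | P i) w i = 1 ->
  lfree_norm (a *: (delta o x - \sum_(i | P i) w i *: delta o (p i))) =
  `|a| * \sum_(i | P i) w i * mdist x (p i).
Proof.
move=> w0 w1; set mu := _ *: _.
have muE f : mu f = a * \sum_(i | P i) w i * (vsval f x - vsval f (p i)).
  rewrite /mu scale_lfunE add_lfunE opp_lfunE sum_lfunE deltaE.
  congr (_ * _); under [RHS]eq_bigr do rewrite mulrBr.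
  rewrite sumrB -mulr_suml w1 mul1r; congr (_ - _).
  by apply: eq_bigr => i _; rewrite scale_lfunE deltaE.
have ub f : lip_norm f <= 1 ->
    `|mu f| <= `|a| * \sum_(i | P i) w i * mdist x (p i).
  move=> f1; rewrite muE normrM ler_wpM2l // (le_trans (ler_norm_sum _ _ _)) //.
  apply: ler_sum => i Pi; rewrite normrM ger0_norm ?w0 // ler_wpM2l ?w0 //.
  have [_ /(_ x (p i)) /le_trans] := lip_normP f; apply.
  by rewrite -[leRHS]mul1r ler_wpM2r ?mdist_ge0.
pose g : subvs_of (lip0 o) :=
  vsproj (lip0 o) [ffun y => (mdist x y - mdist x o : R^o)].
have gE y : vsval g y = mdist x y - mdist x o.
  by rewrite vsprojK ?ffunE // mem_lip0 ffunE subrr.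
have g1 : lip_norm g <= 1.
  apply: lip_norm_le1 => y z; rewrite !gE opprB addrA subrK.
  rewrite ler_distl lerBlDr metric_triangle (metric_sym y z).
  exact: metric_triangle.
have mug : `|mu g| = `|a| * \sum_(i | P i) w i * mdist x (p i).
  rewrite muE normrM; congr (_ * _).
  under eq_bigr do rewrite !gE opprB addrA subrK metric_structure.mdistxx sub0r
    mulrN.
  rewrite sumrN normrN ger0_norm // sumr_ge0 // => i Pi.
  by rewrite mulr_ge0 ?w0 ?mdist_ge0.
apply/eqP; rewrite eq_le; apply/andP; split.
  by apply: ge_sup; [exists `|mu g|, g | move=> _ [f f1 <-]; exact: ub].
rewrite -mug; apply: ub_le_sup; last by exists g.
by eexists => _ [f f1 <-]; apply: ub f1.
Qed.

End FreeSpace.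

(** * Canonical projections of a basis *)

Section Basis.
Context {R : realType} {M : finMetricType R} {o : M} {N : nat}.
Context (b : N.-tuple (lfree o)) (b_basis : basis_of fullv b).

Lemma canon_proj_tnth n (j : 'I_N) :
  canon_proj b n (tnth b j) = if (j < n)%N then tnth b j else 0.
Proof.
have coordb i : coord b i (tnth b j) = (j == i)%:R.
  by rewrite (tnth_nth 0) coord_free // (basis_free b_basis).
rewrite canon_projE big_mkcond (bigD1 j) //= coordb eqxx scale1r.
rewrite big1 ?addr0 // => i /negPf ij.
by rewrite coordb eq_sym ij scale0r; case: ifP.
Qed.

Lemma canon_proj0 : canon_proj b 0 = 0.
Proof. by apply/lfunP => v; rewrite canon_projE big_pred0 ?zero_lfunE. Qed.

Lemma canon_proj_fix k l v : (k <= l)%N ->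
  canon_proj b k v = v -> canon_proj b l v = v.
Proof.
move=> kl <-; rewrite [canon_proj b k v]canon_projE raddf_sum.
by apply: eq_bigr => i ik;
  rewrite /= linearZ /= canon_proj_tnth (leq_trans ik kl).
Qed.

Lemma tnth_basis_neq0 (j : 'I_N) : tnth b j != 0.
Proof. exact: free_not0 (basis_free b_basis) (mem_tnth j b). Qed.

(** Expand b_(j+1) = P_(j+1) b_(j+1) on the point masses of S and apply
    1 - P_j: this fixes b_(j+1) and kills the terms with x in S'. *)
Lemma tnth_basis_decomp (j : 'I_N) (S S' : {set M}) :
  stoch_retraction S (canon_proj b j.+1) ->
  (forall x, x \in S' -> canon_proj b j (delta o x) = delta o x) ->
  exists c : M -> R, tnth b j =
    \sum_(x in S :\: S') c x *: (delta o x - canon_proj b j (delta o x)).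
Proof.
move=> retS fixS'; have [c bjE] := stoch_retraction_range (tnth b j) retS.
exists c; rewrite canon_proj_tnth leqnn in bjE.
transitivity (tnth b j - canon_proj b j (tnth b j)).
  by rewrite canon_proj_tnth ltnn subr0.
rewrite bjE raddf_sum -sumrB (big_setID S') /=.
rewrite big1 ?add0r => [|x /finset.setIP[_ xS']].
  by apply: eq_bigr => x _; rewrite linearZ scalerBr.
by rewrite linearZ /= fixS' // subrr.
Qed.

(** * The two implications *)

(** F lists the points in the order in which they enter the fixed sets, which
    are the only sets that the projections can retract onto; the weights of
    F(k+1) are the masses of its image under P_k. *)
Lemma stoch_basis_form : #|M| = N.+1 -> stoch_basis b ->
  exists (rho : 'I_N -> R) (F : 'I_N.+1 -> M) (lam : 'I_N.+1 -> 'I_N.+1 -> R),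
    stoch_form b rho F lam.
Proof.
move=> cardM stb.
pose A k : {set M} := [set x | canon_proj b k (delta o x) == delta o x]%SET.
have retA k : (k <= N)%N -> stoch_retraction (A k) (canon_proj b k).
  move=> kN.
  have [S oS retS] : exists2 S : {set M}, o \in S
      & stoch_retraction S (canon_proj b k).
    case: k kN => [_|k kN]; last exact: stb.
    exists [set o]%SET; first by rewrite finset.inE.
    by rewrite canon_proj0; exact: stoch_retraction0.
  suff -> : A k = S by [].
  by apply/finset.setP => x;
    rewrite finset.inE (stoch_retraction_memE _ oS retS).
have fixA k x : x \in A k -> canon_proj b k (delta o x) = delta o x.
  by rewrite finset.inE => /eqP.
have A0 : A 0%N = [set o]%SET.
  apply/finset.setP => x; rewrite [LHS]finset.inE canon_proj0.
  by apply: (stoch_retraction_memE _ _ (stoch_retraction0 o));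
    rewrite finset.inE.
have Amono : {homo A : k l / (k <= l)%N >-> k \subset l}.
  move=> k l kl; apply/fintype.subsetP => x.
  by rewrite !finset.inE => /eqP xk; apply/eqP; exact: canon_proj_fix xk.
have Astrict k : (k < N)%N -> ~~ (A k.+1 \subset A k).
  move=> kN; apply/negP; rewrite -finset.setD_eq0 => /eqP AD0.
  have [c] := @tnth_basis_decomp (Ordinal kN) _ _ (retA _ kN) (fixA k).
  rewrite [k.+1]/= AD0 big_set0 => /eqP; apply/negP; exact: tnth_basis_neq0.
have [F [Fbij F0 memF]] := chain_enum cardM A0 Amono Astrict.
have /choice[r rP] : forall k : 'I_N, exists r : {ffun M -> R},
    is_prob_on (A k) r /\ canon_proj b k (delta o (F (lift ord0 k))) = elem o r.
  move=> k; have [r [rprob _ Tr]] := retA k (ltnW (ltn_ord k)).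
  by exists (r (F (lift ord0 k))).
(* Since A k = F{0, ..., k}, a sum carried by A k is a sum over the indices
   below lift ord0 k, which has value k + 1. *)
have sumr (k : 'I_N) (V : nmodType) (G : M -> V) :
    (forall x, x \notin A k -> G x = 0) ->
    \sum_x G x = \sum_(i < N.+1 | (i < lift ord0 k)%N) G (F i).
  move=> G0; rewrite (reindex F) ?[RHS]big_mkcond; last exact: onW_bij.
  apply: eq_bigr => i _; rewrite lift0 ltnS -memF.
  by case: ifPn => // /G0.
have /choice[rho rhoP] : forall k : 'I_N, exists c,
    tnth b k = c *: (delta o (F (lift ord0 k)) - elem o (r k)).
  move=> k; have [c bE] := tnth_basis_decomp (retA _ (ltn_ord k)) (fixA k).
  exists (c (F (lift ord0 k))); rewrite bE.
  rewrite (_ : _ :\: _ = [set F (lift ord0 k)])%SET ?big_set1.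
    by have [_ ->] := rP k.
  apply/finset.setP => x; have [F' F'K FK'] := Fbij.
  rewrite -(FK' x) finset.in_setD finset.in_set1 (bij_eq Fbij) !memF -ltnNge.
  by rewrite -val_eqE /= /bump add1n andbC -eqn_leq.
exists rho, F, (fun m i => if unlift ord0 m is Some k then r k (F i) else 0).
split=> [k|||k m].
- apply: contraNneq (tnth_basis_neq0 k) => r0.
  by rewrite rhoP r0 scale0r.
- by [].
- have lam1 (k : 'I_N) :
    \sum_(i < N.+1 | (i < lift ord0 k)%N) r k (F i) = 1.
    by have [[_ rN r1] _] := rP k; rewrite -sumr.
  split=> [m i|m]; case: unliftP => [k ->|->] // ik.
  have [[r0 _ _] _] := rP k; rewrite r0 -(lam1 k) (bigD1 i) //= lerDl.
  exact: sumr_ge0.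
rewrite /m liftK rhoP elem_delta (sumr k) // => x xN.
by have [[_ -> //]] := rP k; rewrite scale0r.
Qed.

(** Averages of probability measures on F{0, ..., n} are again such measures,
    so the recursion for delta_F(i), pushed through P_n, never leaves them. *)
Lemma stoch_form_basis rho F lam : stoch_form b rho F lam -> stoch_basis b.
Proof.
move=> [rho0 [Fbij F0] [lam0 lam1] bE] n _.
have deltaF (j : 'I_N) (m := lift ord0 j) : delta o (F m) =
    (rho j)^-1 *: tnth b j
    + \sum_(i < N.+1 | (i < m)%N) lam m i *: delta o (F i).
  by rewrite bE scalerA mulVf ?rho0 // scale1r subrK.
have fixF (i : 'I_N.+1) :
    (i <= n)%N -> canon_proj b n (delta o (F i)) = delta o (F i).
  have [k] := ubnP (i : nat); elim: k i => // k IH i.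
  case: (unliftP ord0 i) => [j ->|->] ik le_n; last first.
    by rewrite F0 delta_base linear0.
  rewrite lift0 in le_n; rewrite deltaF linearD linearZ /= canon_proj_tnth le_n.
  congr (_ + _); rewrite raddf_sum; apply: eq_bigr => l lj.
  rewrite /= linearZ /= IH //; first exact: leq_trans lj _.
  by rewrite (leq_trans (ltnW lj)) // lift0.
pose S : {set M} := [set F i | i : 'I_N.+1 & (i <= n)%N]%SET.
have probF (i : 'I_N.+1) : exists p,
    [/\ is_prob_on S p, (i <= n)%N -> p = point_mass (F i)
      & canon_proj b n (delta o (F i)) = elem o p].
  have [k] := ubnP (i : nat); elim: k i => // k IH i ik.
  have [le_n|lt_n] := leqP i n.
    exists (point_mass (F i)); split=> //; last exact: fixF.
    by apply: point_mass_prob; apply/imsetP; exists i; rewrite ?inE.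
  have [j iE|iE] := unliftP ord0 i; last by rewrite iE in lt_n.
  have /choice[q qP] : forall l : 'I_N.+1, exists p, (l < i)%N ->
      is_prob_on S p /\ canon_proj b n (delta o (F l)) = elem o p.
    move=> l; case: (ltnP l i) => [li|_]; last by exists 0.
    by have [|p [? _ ?]] := IH l; [exact: leq_trans li _|exists p].
  exists [ffun y => \sum_(l < N.+1 | (l < i)%N) lam i l * q l y].
  split=> //; last first.
    (* canon_proj b n kills b_(j+1), as j + 1 = i > n, so the image of
       delta (F i) is the lam i-average of the images of the earlier ones. *)
    rewrite iE deltaF -iE linearD linearZ /= canon_proj_tnth.
    have -> : (j < n)%N = false by rewrite ltnNge -ltnS -lift0 -iE lt_n.
    rewrite scaler0 add0r elem_delta.
    under [RHS]eq_bigr do rewrite ffunE scaler_suml.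
    rewrite exchange_big raddf_sum; apply: eq_bigr => l li.
    have [_ qE] := qP l li.
    rewrite /= linearZ /= qE elem_delta scaler_sumr.
    by apply: eq_bigr => y _; rewrite scalerA.
  split=> [y|y yS|]; rewrite ?ffunE.
  - apply: sumr_ge0 => l li; have [[q0 _ _] _] := qP l li.
    by rewrite mulr_ge0 //; case/andP: (lam0 i l li).
  - by rewrite big1 // => l li; have [[_ -> //] _] := qP l li; rewrite mulr0.
  under eq_bigr do rewrite ffunE.
  rewrite exchange_big -[RHS](lam1 i) /=; last by rewrite iE lift0.
  apply: eq_bigr => l li; have [[_ _ q1] _] := qP l li.
  by rewrite -mulr_sumr q1 mulr1.
exists S; first by rewrite -F0; apply/imsetP; exists ord0; rewrite ?inE.
have [F' FK FK'] := Fbij.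
have /choice[r rP] := fun x => probF (F' x).
exists r; split=> x; have [rprob rpt rE] := rP x; rewrite ?FK' // in rpt rE *.
by move=> /imsetP[i]; rewrite finset.inE => i_n xE; apply: rpt; rewrite xE FK.
Qed.

End Basis.

Theorem proposition3p1 (R : realType) (M : finMetricType R) (o : M) (N : nat)
    (cardM : #|M| = N.+1) (b : N.-tuple (lfree o))
    (b_basis : basis_of fullv b) :
  (stoch_basis b <->
   exists (rho : 'I_N -> R) (F : 'I_N.+1 -> M) (lam : 'I_N.+1 -> 'I_N.+1 -> R),
     stoch_form b rho F lam) /\
  (forall (rho : 'I_N -> R) (F : 'I_N.+1 -> M) (lam : 'I_N.+1 -> 'I_N.+1 -> R),
     stoch_form b rho F lam ->
     forall n : 'I_N, let m := lift ord0 n in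
       lfree_norm (tnth b n) =
       `|rho n| * \sum_(i < N.+1 | (i < m)%N) lam m i * mdist (F m) (F i)).
Proof.
split; first split.
- exact: stoch_basis_form.
- by move=> [rho [F [lam]]]; exact: stoch_form_basis.
move=> rho F lam [_ _ [lam0 lam1] bE] n m; rewrite bE.
apply: lfree_norm_barycenter => [i /lam0 /andP[] //|].
by apply: lam1; rewrite lift0.
Qed.
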